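(* Let $f:\mathbb{R}^n\to\bar{\mathbb{R}}$ and $g:\mathbb{R}^m\to\bar{\mathbb{R}}$ be lower semicontinuous proper convex functions, let $A\in\mathbb{R}^{m\times n}$ be a matrix, and let $T_a:=T_a(A\operatorname{dom}(f),\operatorname{dom}(g))$ be the affine joint supporting subspace. Then $$\inf_{x\in\mathbb{R}^n}\,[f(x)+g(Ax)]=-\min_{y\in\mathbb{R}^m}\,\big[(f+\iota_{A^{-1}(T_a)})^*(A^Ty)+(g+\iota_{T_a})^*(-y)\big],$$ where $\min$ means that the infimum over $y$ (in $\bar{\mathbb{R}}$) is attained.
   Context: $\bar{\mathbb{R}}=\mathbb{R}\cup\{-\infty,\infty\}$. For convex $f$, $\operatorname{dom}(f)=\{x: f(x)\neq\infty\}$; $f$ is proper if it is nowhere $-\infty$ and $\operatorname{dom}(f)\ne\emptyset$. The convex conjugate is $f^*(y)=\sup_x\langle y,x\rangle-f(x)$. For a set $S$, $\iota_S$ is the indicator function, $0$ on $S$ and $\infty$ off $S$. A matrix $A$ is identified with its linear map; $AS$ is the image of $S$ and $A^{-1}(S)$ the preimage of $S$ (no invertibility assumed). $B\pm B'=\{b\pm b'\mid b\in B,b'\in B'\}$. Faces: for $C\subseteq\mathbb{R}^m$ convex, a subset $F\subseteq C$ is a face of $C$ if for all $y,z\in C$, whenever the open segment $]y,z[ = [y,z]\setminus\{y,z\}$ meets $F$, both $y,z\in F$. For $S\subseteq C$, $F_C(S)$ denotes the smallest face of $C$ containing $S$; $F_C(x)=F_C(\{x\})$. Joint supporting subspace: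 for convex $C,D\subseteq\mathbb{R}^m$ with $C\cap D\neq\emptyset$, $T(C,D):=\operatorname{Span} F_{C-D}(0)$ (linear span) and $T_a(C,D):=T(C,D)+(C\cap D)$. If $C\cap D=\emptyset$, then $T_a(C,D)=\emptyset$. *)

(* Defs.v *)
From HB Require Import structures.
From mathcomp Require Import all_boot all_order all_algebra.
From mathcomp Require Import all_classical all_reals all_analysis.

Set Implicit Arguments.
Unset Strict Implicit.
Unset Printing Implicit Defensive.
Import Order.TTheory GRing.Theory Num.Theory.
Import numFieldNormedType.Exports.
Local Open Scope classical_set_scope.
Local Open Scope ring_scope.

Section Functions.
Context {R : realType} {n : nat}.
Implicit Types (f : 'cV[R]_n -> \bar R) (x y : 'cV[R]_n) (S : set 'cV[R]_n).

Definition dotv y x : R := \sum_i y i 0 * x i 0.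

Definition edom f : set 'cV[R]_n := [set x | f x <> +oo%E].

Definition eproper f : Prop := (forall x, f x <> -oo%E) /\ edom f !=set0.

Definition epigraph f : set ('cV[R]_n * R^o) := [set p | (f p.1 <= p.2%:E)%E].

Definition econvex f : Prop :=
  @convex_set R ('cV[R]_n * R^o)%type (epigraph f).

Definition econjugate f y : \bar R :=
  ereal_sup [set ((dotv y x)%:E - f x)%E | x in setT].

Definition iota_set S x : \bar R := if x \in S then 0%E else +oo%E.

End Functions.

Section Faces.
Context {R : realType} {V : lmodType R}.
Implicit Types (C F S : set V) (y z : V).

Definition open_segment y z : set V :=
  [set (1 - t) *: y + t *: z | t in `[0, 1]%classic] `\` [set y; z].

(* A face is not required to be convex; the empty set is a face. *)
Definition is_face C F : Prop :=
  F `<=` C /\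
  forall y z, C y -> C z -> open_segment y z `&` F !=set0 -> F y /\ F z.

(* The intersection of all faces of [C] containing [S]. Faces are stable under
   nonempty intersections, so this is the smallest such face when [S `<=` C];
   otherwise there is no such face and the value is [setT]. *)
Definition face_gen C S : set V := smallest (is_face C) S.

Lemma face_gen_is_face C S : S `<=` C -> is_face C (face_gen C S).
Proof.
move=> SC; split.
  apply: smallest_sub => //; split=> // y z Cy Cz _; by split.
move=> y z Cy Cz [x [xyz Fx]]; split=> G [fG SG].
- have [] := fG.2 y z Cy Cz => //.
  by exists x; split=> //; apply: Fx.
- have [] := fG.2 y z Cy Cz => //.
  by exists x; split=> //; apply: Fx.
Qed.

End Faces.

Section JointSupportingSubspace.
Context {R : realType} {m : nat}.
Implicit Types (C D S : set 'cV[R]_m).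

Definition linear_span S : set 'cV[R]_m :=
  smallest (range (fun U : {vspace 'cV[R]_m} => [set` U])) S.

Definition setB_mink C D : set 'cV[R]_m := [set c - d | c in C & d in D].

Definition setD_mink C D : set 'cV[R]_m := [set c + d | c in C & d in D].

(* Meaningful only when [C] and [D] meet, i.e. when [0] lies in [C - D]. *)
Definition joint_supp C D : set 'cV[R]_m :=
  linear_span (face_gen (setB_mink C D) [set 0]).

(* Empty when [C] and [D] are disjoint, being a sum with the empty set. *)
Definition joint_supp_aff C D : set 'cV[R]_m :=
  setD_mink (joint_supp C D) (C `&` D).

Lemma joint_supp_aff_disjoint C D :
  C `&` D = set0 -> joint_supp_aff C D = set0.
Proof. by move=> CD; rewrite -subset0 => v [t _ [x]]; rewrite CD. Qed.

End JointSupportingSubspace.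

(* Main.v *)
Require Import Defs.
From mathcomp Require Import all_boot all_order all_algebra.
From mathcomp Require Import all_classical all_reals all_analysis.
From mathcomp Require Import ring lra.
Import Order.TTheory GRing.Theory Num.Theory.
Import numFieldNormedType.Exports.
Local Open Scope classical_set_scope.
Local Open Scope ring_scope.
Set Implicit Arguments.
Unset Strict Implicit.
Unset Printing Implicit Defensive.

(** Write C = A (dom f), D = dom g, B = C - D, and let Ta be the affine joint
    supporting subspace of C and D. Restricting f to the preimage of Ta and g
    to Ta leaves the primal problem unchanged, because C `&` D is contained in
    Ta ([joint_supp_aff_meet]); weak duality for the restricted functions
    ([weak_duality]) is then the usual Fenchel-Young computation.

    The point of the restriction is that it creates a constraint qualification
    where the original functions need not have one. The smallest face of B
    containing 0 consists of the u in B such that some negative multiple of u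
    is also in B, and its span T consists of the directions in which B extends
    both ways from 0 ([symdir], [span_face0]). Since x - y and y - x are in B
    for x, y in C `&` D, the set Ta is the single translate x + T of T
    ([joint_supp_affE]). Every u = c - d with c in C `&` Ta and d in D `&` Ta
    is then in T, so - e *: u = c' - d' for some e > 0, c' in C and d' in D.
    The points dividing the segments [c, c'] and [d, d'] in the ratio 1 : e
    coincide; their common value q is in C `&` D, hence in Ta, and c', which
    lies on the line through c and q, is in Ta as well; so is d'. Thus
    (C `&` Ta) - (D `&` Ta) absorbs a negative multiple of each of its
    elements ([joint_supp_aff_regular]): 0 is in its relative interior.

    That property is all that Fenchel duality requires. When the primal value p
    is finite, the set E of the pairs (Ax - z, a + b - p), where a and b bound
    the restricted functions at x and z, is convex and lies above 0 over the
    origin. A linear functional y lying below E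
    ([convex_supporting_functional]) is a dual point of value at most - p
    ([strong_duality]). This functional is built one coordinate at a time,
    as in the Hahn-Banach theorem ([cone_supporting_functional]).

    When C and D are disjoint, Ta is empty, the primal value is +oo and the
    dual function is identically -oo. *)

(** * Extended-valued convex functions and their conjugates *)

(** Convexity with both weights explicit: the arguments below produce them as
    quotients that sum to one, rather than as t and 1 - t. *)
Definition segment_closed (R : realType) (V : lmodType R) (B : set V) :=
  forall u v a b, 0 <= a -> 0 <= b -> a + b = 1 ->
  B u -> B v -> B (a *: u + b *: v).
Arguments segment_closed {R V} B.

Section ExtendedConvexity.
Context {R : realType} {n : nat}.
Implicit Types (f h : 'cV[R]_n -> \bar R) (S : set 'cV[R]_n).

Lemma econvex_le f x y (r s a b : R) : econvex f ->
  0 <= a -> 0 <= b -> a + b = 1 -> (f x <= r%:E)%E -> (f y <= s%:E)%E ->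
  (f (a *: x + b *: y)%R <= (a * r + b * s)%:E)%E.
Proof.
move=> cf a0 b0 ab fx fy; have a1 : a <= 1 by lra.
have /set_mem := cf (x, r) (y, s) (Itv01 a0 a1) (mem_set fx) (mem_set fy).
rewrite /epigraph /=.
by have -> : b = 1 - a by lra.
Qed.

Lemma edom_le f x : (forall z, f z <> -oo%E) -> edom f x ->
  exists r : R, (f x <= r%:E)%E.
Proof.
move=> fN; rewrite /edom /=; have := fN x.
by case: (f x) => [r| |] // _ _; exists r.
Qed.

Lemma le_edom f x (r : R) : (f x <= r%:E)%E -> edom f x.
Proof. by rewrite /edom /=; case: (f x). Qed.

Lemma edom_segment_closed f : (forall z, f z <> -oo%E) -> econvex f ->
  segment_closed (edom f).
Proof.
move=> fN cf x y a b a0 b0 ab /(edom_le fN)[r fr] /(edom_le fN)[s fs].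
exact: le_edom (econvex_le cf a0 b0 ab fr fs).
Qed.

(** Adding the indicator of S to f intersects the epigraph of f with the cylinder
    over S; conjugates are only ever bounded through epigraphs. *)
Lemma iota_leP f S x (r : R) : (forall z, f z <> -oo%E) ->
  (f x + iota_set S x <= r%:E)%E <-> S x /\ (f x <= r%:E)%E.
Proof.
move=> fN; rewrite /iota_set; case: ifPn => [/set_mem Sx|/negP Sx].
  by rewrite adde0; split=> [|[]].
split=> [|[/mem_set] //].
by have := fN x; case: (f x).
Qed.

(** The Fenchel-Young inequality, in terms of a point (x, r) of the epigraph. *)
Lemma econjugate_ge h y x (r : R) :
  (h x <= r%:E)%E -> ((dotv y x - r)%:E <= econjugate h y)%E.
Proof.
move=> hr; apply: le_ereal_sup_tmp; exists ((dotv y x)%:E - h x)%E.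
  by exists x.
by rewrite EFinB leeB.
Qed.

(** Points where h is +oo contribute -oo to the supremum, so a bound over the
    epigraph is enough. *)
Lemma econjugate_le h y (s : R) : (forall z, h z <> -oo%E) ->
  (forall x r, (h x <= r%:E)%E -> dotv y x - r <= s) ->
  (econjugate h y <= s%:E)%E.
Proof.
move=> hN hs; apply: ge_ereal_sup => _ [x _ <-].
have := hN x; have := hs x; case: (h x) => [r| |] // H _.
  by rewrite -EFinB lee_fin H.
by rewrite /= leNye.
Qed.

Lemma dotvDl (y z x : 'cV[R]_n) : dotv (y + z) x = dotv y x + dotv z x.
Proof. by rewrite /dotv -big_split; apply: eq_bigr => i _; rewrite mxE mulrDl. Qed.

Lemma dotvDr (y x z : 'cV[R]_n) : dotv y (x + z) = dotv y x + dotv y z.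
Proof. by rewrite /dotv -big_split; apply: eq_bigr => i _; rewrite mxE mulrDr. Qed.

Lemma dotvZl (y : 'cV[R]_n) (a : R) (x : 'cV[R]_n) : dotv (a *: y) x = a * dotv y x.
Proof. by rewrite /dotv mulr_sumr; apply: eq_bigr => i _; rewrite mxE mulrA. Qed.

Lemma dotvZr (y : 'cV[R]_n) (a : R) (x : 'cV[R]_n) : dotv y (a *: x) = a * dotv y x.
Proof. by rewrite /dotv mulr_sumr; apply: eq_bigr => i _; rewrite mxE mulrCA. Qed.

Lemma dotvNl (y x : 'cV[R]_n) : dotv (- y) x = - dotv y x.
Proof. by rewrite -scaleN1r dotvZl mulN1r. Qed.

Lemma dotvNr (y x : 'cV[R]_n) : dotv y (- x) = - dotv y x.
Proof. by rewrite -scaleN1r dotvZr mulN1r. Qed.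

Lemma dotv_delta (i : 'I_n) (x : 'cV[R]_n) : dotv (delta_mx i 0) x = x i 0.
Proof.
rewrite /dotv (bigD1 i) //= mxE !eqxx mul1r big1 ?addr0 // => j ji.
by rewrite mxE (negPf ji) mul0r.
Qed.

End ExtendedConvexity.

Lemma dotv_tr_mul (R : realType) (n m : nat) (A : 'M[R]_(m, n)) y x :
  dotv (A^T *m y) x = dotv y (A *m x).
Proof.
have dotvE k (u v : 'cV[R]_k) : dotv u v = (u^T *m v) 0 0.
  by rewrite mxE; apply: eq_bigr => i _; rewrite mxE.
by rewrite !dotvE trmx_mul trmxK mulmxA.
Qed.

(** * The span of the minimal face *)

Section ConvexSets.
Context {R : realType} {m : nat}.
Implicit Types (B C D : set 'cV[R]_m) (u v : 'cV[R]_m).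

Lemma image_segment_closed n (A : 'M[R]_(m, n)) (S : set 'cV[R]_n) :
  segment_closed S -> segment_closed (mulmx A @` S).
Proof.
move=> cS _ _ a b a0 b0 ab [x Sx <-] [y Sy <-].
by exists (a *: x + b *: y); [exact: cS|rewrite mulmxDr -!scalemxAr].
Qed.

Lemma setB_mink_segment_closed C D :
  segment_closed C -> segment_closed D -> segment_closed (setB_mink C D).
Proof.
move=> cC cD _ _ a b a0 b0 ab [c Cc [d Dd <-]] [c' Cc' [d' Dd' <-]].
exists (a *: c + b *: c'); first exact: cC.
exists (a *: d + b *: d'); first exact: cD.
by rewrite !scalerBr opprD addrACA.
Qed.

(** When B is convex and contains 0, this is the lineality space of the convex
    cone generated by B, that is, the set of directions in which B extends both
    ways from 0. *)
Definition symdir B : set 'cV[R]_m :=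
  [set u | exists2 e : R, 0 < e & B (e *: u) /\ B (- e *: u)].

Lemma symdir0 B : B 0 -> symdir B 0.
Proof. by move=> B0; exists 1; rewrite ?scaler0 // ltr01. Qed.

Lemma symdirZ B a u : B 0 -> symdir B u -> symdir B (a *: u).
Proof.
move=> B0 [e e0 [Bu BNu]].
have [->|a0] := eqVneq a 0; first by rewrite scale0r; exact: symdir0.
exists (e / `|a|); first by rewrite divr_gt0 // normr_gt0.
rewrite !scalerA; have [ap|an] := ger0P a.
- have -> : e / a * a = e by field.
  by have -> : - (e / a) * a = - e by field.
- have -> : e / - a * a = - e by field.
  by have -> : - (e / - a) * a = e by field.
Qed.

Lemma symdirD B u v : segment_closed B ->
  symdir B u -> symdir B v -> symdir B (u + v).
Proof.
move=> cB [e e0 [Bu BNu]] [d d0 [Bv BNv]].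
have ed0 : 0 < e + d by exact: addr_gt0.
have edn : e + d != 0 by rewrite gt_eqF.
have p1 : 0 <= d / (e + d) by rewrite divr_ge0 // ltW.
have p2 : 0 <= e / (e + d) by rewrite divr_ge0 // ltW.
have p12 : d / (e + d) + e / (e + d) = 1 by field.
exists (e * d / (e + d)); first by rewrite divr_gt0 // mulr_gt0.
split.
- have := cB _ _ _ _ p1 p2 p12 Bu Bv.
  by congr B; apply/matrixP => i j; rewrite !mxE; field.
- have := cB _ _ _ _ p1 p2 p12 BNu BNv.
  by congr B; apply/matrixP => i j; rewrite !mxE; field.
Qed.

(** The same scale has to serve for both signs in [symdir]: e / (1 + e) does,
    as both points are then obtained by shrinking B towards 0. *)
Lemma symdir_opp B u e : segment_closed B -> B 0 ->
  B u -> 0 < e -> B (- e *: u) -> symdir B u.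
Proof.
move=> cB B0 Bu e0 BNu.
have e1n : 1 + e != 0 by rewrite gt_eqF // addr_gt0.
have p1 : 0 <= e / (1 + e) by rewrite divr_ge0 // ltW // addr_gt0.
have p2 : 0 <= 1 / (1 + e) by rewrite divr_ge0 // ltW // addr_gt0.
have p12 : e / (1 + e) + 1 / (1 + e) = 1 by field.
exists (e / (1 + e)); first by rewrite divr_gt0 // addr_gt0.
split.
- have := cB _ _ _ _ p1 p2 p12 Bu B0.
  by congr B; apply/matrixP => i j; rewrite !mxE; field.
- have := cB _ _ _ _ p2 p1 (etrans (addrC _ _) p12) BNu B0.
  by congr B; apply/matrixP => i j; rewrite !mxE; field.
Qed.

(** A subspace of maximal dimension among those contained in W must be all of W,
    since adjoining the line through a further point of W would enlarge it. *)
Lemma submodule_vspace (W : set 'cV[R]_m) : W 0 ->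
  (forall a u, W u -> W (a *: u)) -> (forall u v, W u -> W v -> W (u + v)) ->
  exists U : {vspace 'cV[R]_m}, W = [set` U].
Proof.
move=> W0 WZ WD.
pose P k := `[< exists2 U : {vspace 'cV[R]_m}, [set` U] `<=` W & \dim U = k >].
have exP : exists k, P k.
  exists 0%N; apply/asboolP; exists 0%VS; last exact: dimv0.
  by move=> u /=; rewrite memv0 => /eqP ->.
have ubP k : P k -> (k <= dim 'cV[R]_m)%N.
  by move=> /asboolP[U _ <-]; rewrite -dimvf dimvS // subvf.
case: (ex_maxnP exP ubP) => k /asboolP[U UW Uk] kmax.
exists U; apply/seteqP; split=> // w Ww /=.
have sub : [set` (U + <[w]>)%VS] `<=` W.
  move=> _ /memv_addP[u uU [_ /vlineP[a ->] ->]].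
  by apply: WD; [exact: UW|exact: WZ].
have dimle : (\dim (U + <[w]>)%VS <= \dim U)%N.
  by rewrite Uk; apply: kmax; apply/asboolP; exists (U + <[w]>)%VS.
have -> : U = (U + <[w]>)%VS by apply/eqP; rewrite eqEdim addvSl.
by rewrite memvE addvSr.
Qed.

(** If x = (1 - t) y + t z and - e x is in B, mixing - e x with z so as to cancel
    the component along z leaves a negative multiple of y in B. *)
Lemma face_endpoint B y z t : segment_closed B -> B 0 -> B y -> B z ->
  0 <= t -> t < 1 -> symdir B ((1 - t) *: y + t *: z) -> symdir B y.
Proof.
move=> cB B0 By Bz t0 t1 [e e0 [_ BN]].
have et : 0 < 1 + e * t by rewrite ltr_pwDl // mulr_ge0 // ltW.
have etn : 1 + e * t != 0 by rewrite gt_eqF.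
have p1 : 0 <= 1 / (1 + e * t) by rewrite divr_ge0 // ltW.
have p2 : 0 <= e * t / (1 + e * t) by rewrite divr_ge0 ?mulr_ge0 // ltW.
have p12 : 1 / (1 + e * t) + e * t / (1 + e * t) = 1 by field.
apply: (@symdir_opp B y (e * (1 - t) / (1 + e * t))) => //.
  by rewrite divr_gt0 // mulr_gt0 // subr_gt0.
have := cB _ _ _ _ p1 p2 p12 BN Bz.
by congr B; apply/matrixP => i j; rewrite !mxE; field.
Qed.

Lemma symdir_face B : segment_closed B -> B 0 ->
  is_face B (B `&` symdir B).
Proof.
move=> cB B0; split=> [u []//|y z By Bz [_ [[[t /= + <-]] nyz [_ Lx]]]].
rewrite in_itv /= => /andP[t0 t1].
have tn1 : t != 1.
  by apply: contra_notN nyz => /eqP ->; right; rewrite subrr scale0r scale1r add0r.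
have tn0 : t != 0.
  by apply: contra_notN nyz => /eqP ->; left; rewrite subr0 scale0r scale1r addr0.
split; split=> //.
- by apply: (face_endpoint cB B0 By Bz t0 _ Lx); rewrite lt_neqAle tn1.
- apply: (@face_endpoint B z y (1 - t)) => //; first by rewrite subr_ge0.
    by rewrite gtrBl lt_neqAle eq_sym tn0.
  by rewrite subKr addrC.
Qed.

(** A face containing 0 contains both endpoints of any segment of B centred at 0. *)
Lemma face_gen_sym B w : B w -> B (- w) -> face_gen B [set 0] w.
Proof.
move=> Bw BNw F [Fface F0]; have {}F0 : F 0 by exact: F0.
have [->//|w0] := eqVneq w 0.
suff [] : F w /\ F (- w) by [].
apply: Fface.2 => //; exists 0; split=> //; split.
  exists (2^-1) => /=; first by rewrite in_itv /=; apply/andP; split; lra.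
  by apply/matrixP => i j; rewrite !mxE; field.
by case=> /esym /eqP; rewrite ?oppr_eq0 (negPf w0).
Qed.

(** The elements of B in [symdir] B form a face, which therefore contains the
    minimal one; conversely every u in [symdir] B has a multiple e *: u
    with both e *: u and its opposite in B, and such a point belongs to every
    face containing 0. *)
Lemma span_face0 B : segment_closed B -> B 0 ->
  linear_span (face_gen B [set 0]) = symdir B.
Proof.
move=> cB B0; apply/seteqP; split.
  have [U UE] := submodule_vspace (symdir0 B0) (fun a u => @symdirZ B a u B0)
    (fun u v => symdirD cB).
  rewrite UE; apply: smallest_sub; first by exists U.
  rewrite -UE; apply: subset_trans (@subIsetr _ B _).
  apply: smallest_sub; first exact: symdir_face.
  by move=> _ ->; split=> //; exact: symdir0.
move=> u [e e0 [Bu BNu]] _ [[U _ <-] FU] /=.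
have : [set` U] (e *: u).
  by apply: FU; apply: face_gen_sym => //; rewrite -scaleNr.
move=> /(memvZ e^-1); rewrite scalerA mulVf ?scale1r // gt_eqF //.
Qed.

(** * The affine joint supporting subspace *)

Section JointSupport.
Variables (C D : set 'cV[R]_m).
Hypotheses (cC : segment_closed C) (cD : segment_closed D).
Let B := setB_mink C D.

(** Translating by any other common point q gives the same set, because
    q - p and p - q are both in C - D. *)
Lemma joint_supp_affE p : C p -> D p ->
  joint_supp_aff C D = [set v | symdir B (v - p)].
Proof.
move=> Cp Dp; have cB : segment_closed B by exact: setB_mink_segment_closed.
have B0 : B 0 by exists p => //; exists p => //; rewrite subrr.
rewrite /joint_supp_aff /joint_supp span_face0 //; apply/seteqP; split=> v /=.
  move=> [t Lt [q [Cq Dq] <-]]; rewrite -addrA; apply: symdirD => //.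
  exists 1 => //; rewrite scaleN1r scale1r opprB.
  by split; [exists q => //; exists p|exists p => //; exists q].
by move=> Lv; exists (v - p) => //; exists p => //; rewrite subrK.
Qed.

Lemma joint_supp_aff_meet : C `&` D `<=` joint_supp_aff C D.
Proof.
move=> p [Cp Dp]; rewrite (joint_supp_affE Cp Dp) /= subrr; apply: symdir0.
by exists p => //; exists p => //; rewrite subrr.
Qed.

Lemma joint_supp_aff_affine a b u v : a + b = 1 -> C `&` D !=set0 ->
  joint_supp_aff C D u -> joint_supp_aff C D v ->
  joint_supp_aff C D (a *: u + b *: v).
Proof.
move=> ab [p [Cp Dp]]; rewrite (joint_supp_affE Cp Dp) /= => Lu Lv.
have B0 : B 0 by exists p => //; exists p => //; rewrite subrr.
have -> : a *: u + b *: v - p = a *: (u - p) + b *: (v - p).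
  have -> : a = 1 - b by lra.
  by apply/matrixP => i j; rewrite !mxE; ring.
by apply: symdirD; [exact: setB_mink_segment_closed|exact: symdirZ|exact: symdirZ].
Qed.

(** The constraint qualification: inside the affine joint supporting subspace,
    the sets C and D meet in such a way that 0 is in the relative interior of
    their difference. The point q below divides both [c, c'] and [d, d'] in the
    ratio 1 : e, so it is common to C and D. *)
Lemma joint_supp_aff_regular c d : C `&` D !=set0 ->
    C c -> D d -> joint_supp_aff C D c -> joint_supp_aff C D d ->
  exists e c' d', [/\ 0 < e, C c' /\ joint_supp_aff C D c',
    D d' /\ joint_supp_aff C D d' & - e *: (c - d) = c' - d'].
Proof.
move=> [p [Cp Dp]] Cc Dd Tc Td.
have ne : C `&` D !=set0 by exists p.
have cB : segment_closed B by exact: setB_mink_segment_closed.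
have B0 : B 0 by exists p => //; exists p => //; rewrite subrr.
have : symdir B (c - d).
  have -> : c - d = (c - p) + (-1) *: (d - p).
    by apply/matrixP => i j; rewrite !mxE; ring.
  move: Tc Td; rewrite (joint_supp_affE Cp Dp) /= => Lc Ld.
  by apply: symdirD => //; exact: symdirZ.
move=> [e e0 [_ [c' Cc' [d' Dd' cd']]]].
have e1 : 1 + e != 0 by rewrite gt_eqF // addr_gt0.
have p1 : 0 <= e / (1 + e) by rewrite divr_ge0 // ltW // addr_gt0.
have p2 : 0 <= 1 / (1 + e) by rewrite divr_ge0 // ltW // addr_gt0.
have p12 : e / (1 + e) + 1 / (1 + e) = 1 by field.
have cq := cC p1 p2 p12 Cc Cc'.
have dq := cD p1 p2 p12 Dd Dd'.
have qE : e / (1 + e) *: c + 1 / (1 + e) *: c' =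
          e / (1 + e) *: d + 1 / (1 + e) *: d'.
  have -> : c' = d' - e *: (c - d) by rewrite -scaleNr -cd' addrC subrK.
  by apply/matrixP => i j; rewrite !mxE; field.
set q := e / (1 + e) *: c + _ in cq qE.
have Tq : joint_supp_aff C D q.
  by apply: joint_supp_aff_meet; split; rewrite // qE.
have a1 : - e + (1 + e) = 1 by ring.
exists e, c', d'; split=> //; split=> //.
- have -> : c' = - e *: c + (1 + e) *: q.
    by apply/matrixP => i j; rewrite !mxE; field.
  exact: joint_supp_aff_affine.
- have -> : d' = - e *: d + (1 + e) *: q.
    by rewrite qE; apply/matrixP => i j; rewrite !mxE; field.
  exact: joint_supp_aff_affine.
Qed.

End JointSupport.

(** * Supporting functionals *)

(** Finite-dimensional Hahn-Banach theorem for the convex cone K, read as an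
    epigraph over its projection. The hypothesis on - u says that this
    projection is a linear subspace, which may be proper. The functional is built
    by induction on k, for those u whose coordinates of index at least k vanish;
    the value c on the new coordinate is the infimum of the upper
    slopes, and the [cross] inequality puts every lower slope below all of these. *)
Lemma cone_supporting_functional (K : 'cV[R]_m -> R -> Prop) :
    (forall u v r s, K u r -> K v s -> K (u + v) (r + s)) ->
    (forall a u r, 0 < a -> K u r -> K (a *: u) (a * r)) ->
    (forall u r, K u r -> exists s, K (- u) s) ->
    (forall r, K 0 r -> 0 <= r) ->
  exists y, forall u r, K u r -> dotv y u <= r.
Proof.
move=> KD KZ KN K0.
suff step k : (k <= m)%N -> exists y, forall u r,
    (forall i : 'I_m, (k <= i)%N -> u i 0 = 0) -> K u r -> dotv y u <= r.
  have [y Hy] := step m (leqnn m).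
  by exists y => u r; apply: Hy => i; rewrite leqNgt ltn_ord.
elim: k => [_|k IH km].
  exists 0 => u r u0 Kur; have uE : u = 0.
    by apply/matrixP => i j; rewrite ord1 mxE u0.
  by move: Kur; rewrite uE -(scale0r 0) dotvZr mul0r scale0r; exact: K0.
have [y Hy] := IH (ltnW km); pose o := Ordinal km.
pose supp (u : 'cV[R]_m) := forall i : 'I_m, (k < i)%N -> u i 0 = 0.
(* The set is empty when all these vectors have a zero coordinate of index k;
   the default value of inf is then multiplied by zero below. *)
pose c := inf [set s | exists u r, [/\ K u r, supp u, u o 0 = 1 & s = r - dotv y u]].
(* The new coordinates of u and v cancel, so y is below K at u + v. *)
have cross u r v s : K u r -> supp u -> u o 0 = 1 ->
    K v s -> supp v -> v o 0 = - 1 -> dotv y v - s <= r - dotv y u.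
  move=> Ku su uo Kv sv vo.
  have := Hy (u + v) (r + s) _ (KD _ _ _ _ Ku Kv); rewrite dotvDr.
  suff H : forall i : 'I_m, (k <= i)%N -> (u + v) i 0 = 0 by move=> /(_ H); lra.
  move=> i; rewrite leq_eqVlt => /predU1P[ki|ki]; rewrite mxE.
    by have -> : i = o by [apply/val_inj]; rewrite uo vo subrr.
  by rewrite su // sv // addr0.
have suppZ a u : supp u -> supp (a *: u) by move=> su i ki; rewrite mxE su // mulr0.
have c_le u r : K u r -> supp u -> u o 0 = 1 -> c <= r - dotv y u.
  move=> Ku su uo; apply: ge_inf; last by exists u, r.
  have [s Ks] := KN _ _ Ku; exists (dotv y (- u) - s) => _ [v [t [Kv sv vo ->]]].
  apply: cross => //; last by rewrite mxE uo.
  by rewrite -scaleN1r; exact: suppZ.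
have c_ge u r : K u r -> supp u -> u o 0 = - 1 -> dotv y u - r <= c.
  move=> Ku su uo; apply: lb_le_inf.
    have [s Ks] := KN _ _ Ku; exists (s - dotv y (- u)), (- u), s; split=> //.
      by rewrite -scaleN1r; exact: suppZ.
    by rewrite mxE uo opprK.
  by move=> _ [v [t [Kv sv vo ->]]]; exact: cross.
exists (y + c *: delta_mx o 0) => u r su Ku.
rewrite dotvDl dotvZl dotv_delta.
have [u0|u0|u0] := ltrgtP (u o 0) 0.
- have a0 : 0 < - (u o 0)^-1 by rewrite oppr_gt0 invr_lt0.
  have uo : (- (u o 0)^-1 *: u) o 0 = - 1 by rewrite mxE mulNr mulVf // lt_eqF.
  have := c_ge _ _ (KZ _ _ _ a0 Ku) (suppZ _ _ su) uo.
  rewrite dotvZr -mulrBr -(ler_nM2l u0).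
  have -> : u o 0 * (- (u o 0)^-1 * (dotv y u - r)) = r - dotv y u.
    by field; rewrite lt_eqF.
  by lra.
- have a0 : 0 < (u o 0)^-1 by rewrite invr_gt0.
  have uo : ((u o 0)^-1 *: u) o 0 = 1 by rewrite mxE mulVf // gt_eqF.
  have := c_le _ _ (KZ _ _ _ a0 Ku) (suppZ _ _ su) uo.
  rewrite dotvZr -mulrBr -(ler_pM2l u0).
  have -> : u o 0 * ((u o 0)^-1 * (r - dotv y u)) = r - dotv y u.
    by field; rewrite gt_eqF.
  by lra.
- rewrite u0 mulr0 addr0; apply: Hy => // i.
  rewrite leq_eqVlt => /predU1P[ki|ki]; last exact: su.
  by have -> : i = o by apply/val_inj.
Qed.

(** Apply the theorem for cones to the cone generated by E; the hypothesis on
    - e *: u makes the projection of this cone a linear subspace. *)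
Lemma convex_supporting_functional (E : 'cV[R]_m -> R -> Prop) :
    (forall u v r s a b, 0 <= a -> 0 <= b -> a + b = 1 ->
      E u r -> E v s -> E (a *: u + b *: v) (a * r + b * s)) ->
    (forall u r, E u r -> exists e s, 0 < e /\ E (- e *: u) s) ->
    (forall r, E 0 r -> 0 <= r) ->
  exists y, forall u r, E u r -> dotv y u <= r.
Proof.
move=> cE EN E0.
have [||||y Hy] := @cone_supporting_functional
    (fun u r => exists2 e, 0 < e & E (e *: u) (e * r)); last first.
- by exists y => u r Eur; apply: Hy; exists 1; rewrite ?scale1r ?mul1r.
- move=> r [e e0]; rewrite scaler0 => /E0.
  by rewrite pmulr_rge0.
- move=> u r [e e0 /EN[d [s [d0 Es]]]].
  have ed0 : 0 < e * d by exact: mulr_gt0.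
  exists (s / (e * d)), (e * d) => //.
  have -> : e * d * (s / (e * d)) = s by field; rewrite !gt_eqF.
  by move: Es; rewrite scalerA mulNr mulrC scalerN -scaleNr.
- move=> a u r a0 [e e0 Eu]; exists (e / a); first exact: divr_gt0.
  by rewrite scalerA mulrA divfK ?gt_eqF.
- move=> u v r s [e e0 Eu] [d d0 Ev].
  have ed0 : 0 < e + d by exact: addr_gt0.
  have edn : e + d != 0 by rewrite gt_eqF.
  have p1 : 0 <= d / (e + d) by rewrite divr_ge0 // ltW.
  have p2 : 0 <= e / (e + d) by rewrite divr_ge0 // ltW.
  have p12 : d / (e + d) + e / (e + d) = 1 by field.
  exists (e * d / (e + d)); first by rewrite divr_gt0 // mulr_gt0.
  have := cE _ _ _ _ _ _ p1 p2 p12 Eu Ev.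
  congr (E _ _); last by field.
  by apply/matrixP => i j; rewrite !mxE; field.
Qed.

End ConvexSets.

(** * Fenchel duality *)

Section Duality.
Context {R : realType} {n m : nat}.
Variables (f : 'cV[R]_n -> \bar R) (g : 'cV[R]_m -> \bar R) (A : 'M[R]_(m, n)).
Variable S : set 'cV[R]_m.
Hypotheses (fN : forall x, f x <> -oo%E) (gN : forall z, g z <> -oo%E).

Let primal := ereal_inf [set (f x + g (A *m x))%E | x in setT].
Let dual (y : 'cV[R]_m) : \bar R :=
  (econjugate (fun x => f x + iota_set (mulmx A @^-1` S) x) (A^T *m y)
   + econjugate (fun z => g z + iota_set S z) (- y)%R)%E.

(** Where A x is outside S, f x + g (A x) is +oo and the indicators change
    nothing; elsewhere the inequality is the sum of two Fenchel-Young inequalities. *)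
Lemma weak_duality y : mulmx A @` edom f `&` edom g `<=` S ->
  (- dual y <= primal)%E.
Proof.
move=> sub; apply: le_ereal_inf_tmp => _ [x _ <-].
have [fx|fx] := pselect (f x = +oo%E).
  by rewrite fx addye ?leey //; exact/eqP.
have [gx|gx] := pselect (g (A *m x) = +oo%E).
  by rewrite gx addey ?leey //; exact/eqP.
have SAx : S (A *m x) by apply: sub; split=> //; exists x.
move: (@fN x) (@gN (A *m x)) fx gx.
case Ef : (f x) => [a| |] //; case Eg : (g (A *m x)) => [b| |] // _ _ _ _.
have fa : (f x + iota_set (mulmx A @^-1` S) x <= a%:E)%E.
  by apply/iota_leP => //; rewrite Ef.
have gb : (g (A *m x) + iota_set S (A *m x) <= b%:E)%E.
  by apply/iota_leP => //; rewrite Eg.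
rewrite leeNl; apply: le_trans (leeD (econjugate_ge (A^T *m y) fa) (econjugate_ge (- y) gb)).
rewrite -EFinD -EFinN -EFinD lee_fin dotv_tr_mul dotvNl; lra.
Qed.

(** A functional y below the set E of perturbed primal values satisfies
    dotv y (A x - z) <= a + b - p whenever a and b bound the restrictions of f
    and g at x and z; taking the supremum over z and then over x turns this into
    the bound - p on the dual function at y. *)
Lemma strong_duality :
    econvex f -> econvex g ->
    mulmx A @` edom f `&` edom g !=set0 ->
    mulmx A @` edom f `&` edom g `<=` S ->
    (forall a b u v, a + b = 1 -> S u -> S v -> S (a *: u + b *: v)) ->
    (forall c d, (mulmx A @` edom f) c -> edom g d -> S c -> S d ->
      exists e c' d', [/\ 0 < e, (mulmx A @` edom f) c' /\ S c',
        edom g d' /\ S d' & - e *: (c - d) = c' - d']) ->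
  exists y, (dual y <= - primal)%E.
Proof.
move=> cf cg [_ [[x0 fx0 <-] gx0]] sub Saff Sreg.
have [a0 fa0] := edom_le fN fx0; have [b0 gb0] := edom_le gN gx0.
have S0 : S (A *m x0) by apply: sub; split=> //; exists x0.
have primal_le x a b : (f x <= a%:E)%E -> (g (A *m x) <= b%:E)%E ->
    (primal <= (a + b)%:E)%E.
  move=> fa gb; apply: ge_ereal_inf; exists (f x + g (A *m x))%E; first by exists x.
  by rewrite EFinD leeD.
(* If the primal value is -oo, any dual point will do. *)
case Ep : primal primal_le => [p| |] primal_le; last by exists 0; rewrite leey.
  2: by have := primal_le _ _ _ fa0 gb0.
pose E u r := exists x z a b, [/\ S (A *m x) /\ (f x <= a%:E)%E,
  S z /\ (g z <= b%:E)%E, u = A *m x - z & r = a + b - p].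
have [||| y Hy] := @convex_supporting_functional R m E.
- move=> u v r1 r2 s t s0 t0 st [x [z [a [b [[Sx fx] [Sz gz] {u}-> {r1}->]]]]].
  move=> [x' [z' [a' [b' [[Sx' fx'] [Sz' gz'] {v}-> {r2}->]]]]].
  exists (s *: x + t *: x'), (s *: z + t *: z'), (s * a + t * a'), (s * b + t * b').
  split.
  + split; last exact: econvex_le.
    by rewrite mulmxDr -!scalemxAr; exact: Saff.
  + by split; [exact: Saff|exact: econvex_le].
  + by rewrite mulmxDr -!scalemxAr !scalerBr opprD addrACA.
  + by rewrite (_ : s = 1 - t); [ring|lra].
- move=> u r [x [z [a [b [[Sx fx] [Sz gz] -> _]]]]].
  have [||e [_ [d' [e0 [[x' fx' <-] Sc'] [gd' Sd'] cd]]]] :=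
    Sreg (A *m x) z _ _ Sx Sz.
  + by exists x => //; exact: le_edom fx.
  + exact: le_edom gz.
  have [a' fa'] := edom_le fN fx'; have [b' gb'] := edom_le gN gd'.
  by exists e, (a' + b' - p); split=> //; exists x', d', a', b'.
- move=> r [x [z [a [b [[_ fx] [_ gz] xz ->]]]]].
  have {}xz : A *m x = z by apply/eqP; rewrite -subr_eq0 -xz.
  rewrite -xz in gz.
  by have := primal_le _ _ _ fx gz; rewrite lee_fin; lra.
exists y; rewrite /dual.
set F := fun x => (f x + _)%E; set G := fun z => (g z + _)%E.
have FN x : F x <> -oo%E.
  by rewrite /F /iota_set; have := @fN x; case: (f x); case: ifP.
have GN z : G z <> -oo%E.
  by rewrite /G /iota_set; have := @gN z; case: (g z); case: ifP.
have EFG x z a b : (F x <= a%:E)%E -> (G z <= b%:E)%E ->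
    dotv (A^T *m y) x - a + (dotv (- y) z - b) <= - p.
  move=> /(iota_leP _ _ _ fN) fa /(iota_leP _ _ _ gN) gb.
  have : E (A *m x - z) (a + b - p) by exists x, z, a, b.
  by move=> /Hy; rewrite dotvDr dotvNr dotvNl dotv_tr_mul; lra.
have Fx0 : (F x0 <= a0%:E)%E by apply/iota_leP.
have Gx0 : (G (A *m x0) <= b0%:E)%E by apply/iota_leP.
have Gle x a : (F x <= a%:E)%E ->
    (econjugate G (- y) <= (- p - (dotv (A^T *m y) x - a))%:E)%E.
  by move=> Fx; apply: econjugate_le => // z b Gz; have := EFG _ _ _ _ Fx Gz; lra.
(* The conjugate of G is finite at - y, being bounded on both sides thanks to
   the common point; it can be moved across the inequality before taking the
   supremum over x. *)
have := econjugate_ge (- y) Gx0; have := Gle _ _ Fx0.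
case EG : (econjugate G (- y)) => [s| |] // _ _.
have : (econjugate F (A^T *m y) <= (- p - s)%:E)%E.
  apply: econjugate_le => // x a Fx.
  by have := Gle _ _ Fx; rewrite EG lee_fin; lra.
move=> /(@leeD2r _ s%:E) /le_trans; apply.
by rewrite -EFinD subrK.
Qed.

End Duality.

Theorem corollary5p5 (R : realType) (n m : nat)
    (f : 'cV[R]_n -> \bar R) (g : 'cV[R]_m -> \bar R) (A : 'M[R]_(m, n))
    (f_lsc : lower_semicontinuous f) (f_proper : eproper f) (f_convex : econvex f)
    (g_lsc : lower_semicontinuous g) (g_proper : eproper g) (g_convex : econvex g) :
  let Ta := joint_supp_aff (mulmx A @` edom f) (edom g) in
  let dual := fun y : 'cV[R]_m =>
    (econjugate (fun x => f x + iota_set (mulmx A @^-1` Ta) x) (A^T *m y)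
     + econjugate (fun z => g z + iota_set Ta z) (- y)%R)%E in
  ereal_inf [set (f x + g (A *m x))%E | x in setT]
    = (- ereal_inf [set dual y | y in setT])%E
  /\ exists y0, dual y0 = ereal_inf [set dual y | y in setT].
Proof.
move=> Ta dual; set primal := ereal_inf _.
have [fN _] := f_proper; have [gN _] := g_proper.
have cD : segment_closed (edom g) by exact: edom_segment_closed.
have cC : segment_closed (mulmx A @` edom f).
  by apply: image_segment_closed; exact: edom_segment_closed.
have sub : mulmx A @` edom f `&` edom g `<=` Ta by exact: joint_supp_aff_meet.
have weak y : (- dual y <= primal)%E by exact: weak_duality.
(* By weak duality such a y makes both sides equal and attains the minimum. *)
suff [y Hy] : exists y, (dual y <= - primal)%E.
  have dy : dual y = (- primal)%E.
    by apply/eqP; rewrite eq_le Hy leeNl weak.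
  have infE : ereal_inf [set dual y | y in setT] = (- primal)%E.
    apply/eqP; rewrite eq_le; apply/andP; split.
      by rewrite -dy; apply: ereal_inf_lbound; exists y.
    by apply: le_ereal_inf_tmp => _ [z _ <-]; rewrite leeNl.
  by rewrite infE oppeK; split=> //; exists y.
have [CD|/set0P CD] := eqVneq (mulmx A @` edom f `&` edom g) set0; last first.
  apply: strong_duality => //.
  - by move=> a b u v ab; exact: joint_supp_aff_affine.
  - by move=> c d Cc Dd; exact: joint_supp_aff_regular.
(* No x makes both f x and g (A x) finite. *)
exists 0; have -> : primal = +oo%E.
  apply/ereal_inf_pinfty => _ [x _ <-] /=.
  have [fx|fx] := pselect (f x = +oo%E).
    by rewrite fx addye //; exact/eqP.
  have [gx|gx] := pselect (g (A *m x) = +oo%E).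
    by rewrite gx addey //; exact/eqP.
  suff : (mulmx A @` edom f `&` edom g) (A *m x) by rewrite CD.
  by split=> //; exists x.
rewrite /dual /Ta joint_supp_aff_disjoint //.
have empty k (h : 'cV[R]_k -> \bar R) y : (forall x, h x <> -oo%E) ->
    econjugate (fun x => h x + iota_set set0 x)%E y = -oo%E.
  move=> hN; apply/ereal_sup_ninfty => _ [x _ <-] /=.
  by rewrite /iota_set in_set0 addey //; exact/eqP.
by rewrite preimage_set0 !empty.
Qed.
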